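(* Let $n\ge 2$ and let $A\in\widetilde{\mathcal H}_n$ be such that the automaton group generated by $A$ is infinite. Then either there is a $j\in\mathbb N$ (at least the minimal synchronizing level of $A$) such that the graph of bad pairs $G_j(A)$ has a loop (an edge from a vertex to itself), or the automaton semigroup generated by $A$ contains a free semigroup of rank at least $2$.
   Context: $X_n=\{0,\dots,n-1\}$. A synchronous transducer $A=\langle X_n,Q,\pi,\lambda\rangle$ has finite state set $Q$, transition function $\pi:X_n\times Q\to Q$ and output function $\lambda:X_n\times Q\to X_n$, extended to words by $\pi(\Gamma x,q)=\pi(x,\pi(\Gamma,q))$, $\lambda(\Gamma x,q)=\lambda(\Gamma,q)\lambda(x,\pi(\Gamma,q))$. Each state $q$ induces a continuous map $A_q:X_n^{\mathbb N}\to X_n^{\mathbb N}$; $q$ is a homeomorphism state if $A_q$ is a homeomorphism. Two states are $\omega$-equivalent if they induce the same map; $A$ is minimal if distinct states are never $\omega$-equivalent. The automaton semigroup (resp. group) generated by $A$ is the semigroup (resp. group, when all $A_q$ are homeomorphisms) of self-maps of $X_n^{\mathbb N}$ generated by $\{A_q:q\in Q\}$. Product: $A*B$ has states $Q_A\times Q_B$, $\pi_{A*B}(x,(p,q))=(\pi_A(x,p),\pi_B(\lambda_A(x,p),q))$, $\lambda_{A*B}(x,(p,q))=\lambda_B(\lambda_A(x,p),q)$. $A^i=A*\cdots*A$ ($i$ factors) has states $Q^i$ and transition/output functions $\pi_i,\lambda_i$. $A$ is synchronizing at level $k$ if there is $\mathfrak s:X_n^k\to Q$ with $\pi(\Gamma,q)=\mathfrak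 s(\Gamma)$ for all $\Gamma\in X_n^k$, $q\in Q$; $\mathfrak s(\Gamma)$ is the state forced by $\Gamma$; more generally, a word of length at least $k$ forces the unique state to which it is read from every state. The core of $A$ is the image of $\mathfrak s$, and $A$ is core if it equals its core. $\widetilde{\mathcal P}_n$ is the monoid of finite, synchronous, synchronizing, core transducers, each represented by its minimal transducer. $\widetilde{\mathcal H}_n$ is the set of elements of $\widetilde{\mathcal P}_n$ having a homeomorphism state (then all states are homeomorphism states). Splits. Let $A\in\widetilde{\mathcal P}_n$ and let $r$ be at least the minimal synchronizing level of $A$. For a state $t$ let $W_t$ be the set of words, of length at least the minimal synchronizing level, forcing $t$. A split of length $l\ge 1$ (of the level-$r$ dual $A^\vee_r$) is a triple $((q_1,\dots,q_l),(p_1,\dots,p_l),\Gamma)$ with $q_i,p_i\in Q$, $\Gamma\in X_n^r$, such that there are $s_1,\dots,s_l\in Q$ and distinct $t_1,t_2\in Q$ satisfying: with $\Gamma_0=\Lambda_0=\Gamma$, $\Gamma_i=\lambda(\Gamma_{i-1},p_i)$, $\Lambda_i=\lambda(\Lambda_{i-1},q_i)$ for $1\le i\le l$, one has $\Gamma_i,\Lambda_i\in W_{s_{i+1}}$ for $0\le i\le l-1$, $\Gamma_l\in W_{t_1}$, $\Lambda_l\in W_{t_2}$. Its top is $\{p_1,q_1\}$ and its bottom is $\{t_1,t_2\}$. The bottom of the split depends only on the top if for all $U_1,U_2\in Q^{l-1}$ the triple $((q_1,U_1),(p_1,U_2),\Gamma)$ is also a split with bottom $\{t_1,t_2\}$,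 and moreover for all $u,u'\in Q$, $\pi_{l+1}(\Gamma,(p_1,\dots,p_l,u))=\pi_{l+1}(\Gamma,(p_1,U_2,u'))$ and $\pi_{l+1}(\Gamma,(q_1,\dots,q_l,u))=\pi_{l+1}(\Gamma,(q_1,U_1,u'))$. Graph of bad pairs. $G_r(A)$ is the directed graph whose vertices (the bad pairs) are the tops of those splits of $A^\vee_r$ (of any length) whose bottom depends only on the top; there is an edge from the bad pair $\{x_1,x_2\}$ to the bad pair $\{y_1,y_2\}$ if there is a split of $A^\vee_r$ with top $\{x_1,x_2\}$ and bottom $\{y_1,y_2\}$ whose bottom depends only on the top. *)

(* Defs.v *)
From HB Require Import structures.
From mathcomp Require Import all_boot.
From mathcomp Require Import all_classical topology.

Set Implicit Arguments.
Unset Strict Implicit.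
Unset Printing Implicit Defensive.

Record transducer (n : nat) := Transducer {
  state : finType;
  pi : 'I_n -> state -> state;
  lambda : 'I_n -> state -> 'I_n }.

Section Transducers.
Variable n : nat.
Implicit Types (A B : transducer n) (w : seq 'I_n).

Definition piw A w (q : state A) : state A :=
  foldl (fun q x => pi x q) q w.

Fixpoint lambdaw A w (q : state A) : seq 'I_n :=
  if w is x :: w' then lambda x q :: lambdaw w' (pi x q) else [::].

Lemma piw_rcons A w x (q : state A) : piw (rcons w x) q = pi x (piw w q).
Proof. by rewrite /piw -cats1 foldl_cat. Qed.

Lemma lambdaw_rcons A w x (q : state A) :
  lambdaw (rcons w x) q = rcons (lambdaw w q) (lambda x (piw w q)).
Proof. by elim: w q => //= y w IH q; rewrite IH. Qed.

Definition Xomega : topologicalType :=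
  prod_topology (fun _ : nat => discrete_topology 'I_n).

Definition induced A (q : state A) : Xomega -> Xomega :=
  fun u i => lambda (u i) (piw (mkseq u i) q).

Definition homeomorphism (f : Xomega -> Xomega) : Prop :=
  continuous f /\ exists g, [/\ continuous g, cancel f g & cancel g f].

Definition homeo_state A (q : state A) : Prop := homeomorphism (induced q).

Definition omega_equiv A (p q : state A) : Prop := induced p = induced q.

Definition minimal A : Prop := forall p q : state A, omega_equiv p q -> p = q.

Definition tprod A B : transducer n :=
  @Transducer n (state A * state B)%type
    (fun x s => (pi x s.1, pi (lambda x s.1) s.2))
    (fun x s => lambda (lambda x s.1) s.2).

(* A^(l+1) = A * A^l, with Q * Q^l identified with Q^(l+1): see [powerS_pi]
   and [powerS_lambda]. A^0 is the one-state identity transducer. *)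
Fixpoint power_pi A l (x : 'I_n) : l.-tuple (state A) -> l.-tuple (state A) :=
  if l is l'.+1 return l.-tuple (state A) -> l.-tuple (state A) then
    fun t => [tuple of pi x (thead t)
                :: power_pi (lambda x (thead t)) [tuple of behead t]]
  else id.

Fixpoint power_lambda A l (x : 'I_n) : l.-tuple (state A) -> 'I_n :=
  if l is l'.+1 return l.-tuple (state A) -> 'I_n then
    fun t => power_lambda (lambda x (thead t)) [tuple of behead t]
  else fun=> x.

Definition power A l : transducer n :=
  @Transducer n (l.-tuple (state A)) (@power_pi A l) (@power_lambda A l).

Lemma powerS_pi A l x (q : state A) (t : state (power A l)) :
  pi x ([tuple of q :: t] : state (power A l.+1)) =
  [tuple of (@pi _ (tprod A (power A l)) x (q, t)).1
         :: (@pi _ (tprod A (power A l)) x (q, t)).2].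
Proof.
apply: val_inj => /=; rewrite theadE; congr (_ :: tval (power_pi _ _)).
exact: val_inj.
Qed.

Lemma powerS_lambda A l x (q : state A) (t : state (power A l)) :
  lambda x ([tuple of q :: t] : state (power A l.+1)) =
  @lambda _ (tprod A (power A l)) x (q, t).
Proof. by rewrite /= theadE; congr (power_lambda _ _); exact: val_inj. Qed.

Definition sync_map A k (s : k.-tuple 'I_n -> state A) : Prop :=
  forall (w : k.-tuple 'I_n) (q : state A), piw w q = s w.

Definition sync_at A k : Prop :=
  exists s : k.-tuple 'I_n -> state A, sync_map s.

Definition synchronizing A : Prop := exists k, sync_at A k.

Definition min_sync_level A m : Prop :=
  sync_at A m /\ forall k, sync_at A k -> m <= k.

Definition at_least_min_sync_level A r : Prop :=
  exists2 m, min_sync_level A m & m <= r.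

(* The image of a synchronizing map does not depend on its level. *)
Definition core A : set (state A) := fun t =>
  exists k (s : k.-tuple 'I_n -> state A), sync_map s /\ exists G : k.-tuple 'I_n, s G = t.

Definition is_core A : Prop := forall t : state A, core t.

Definition in_Ptilde A : Prop :=
  [/\ synchronizing A, is_core A & minimal A].

Definition in_Htilde A : Prop :=
  in_Ptilde A /\ exists q : state A, homeo_state q.

Inductive automaton_semigroup A : set (Xomega -> Xomega) :=
| semigroup_gen (q : state A) : automaton_semigroup A (induced q)
| semigroup_comp f g : automaton_semigroup A f -> automaton_semigroup A g ->
    automaton_semigroup A (f \o g).

Inductive automaton_group A : set (Xomega -> Xomega) :=
| group_gen (q : state A) : automaton_group A (induced q)
| group_id : automaton_group A id
| group_comp f g : automaton_group A f -> automaton_group A g ->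
    automaton_group A (f \o g)
| group_inv f g : automaton_group A f -> cancel f g -> cancel g f ->
    automaton_group A g.

(* The homomorphism from the free semigroup on [I] (nonempty words) sending
   each letter [i] to [b i] is injective. *)
Definition free_family (I : Type) (b : I -> Xomega -> Xomega) : Prop :=
  forall u v : seq I, u <> [::] -> v <> [::] ->
    foldr (fun i f => b i \o f) id u = foldr (fun i f => b i \o f) id v ->
    u = v.

Definition contains_free_semigroup_on (S : set (Xomega -> Xomega)) (I : Type) :=
  exists b : I -> Xomega -> Xomega, (forall i, S (b i)) /\ free_family b.

Section Splits.
Variable A : transducer n.
Let Q := state A.

Definition forces w (t : Q) : Prop := forall q : Q, piw w q = t.

Definition W (t : Q) : set (seq 'I_n) := fun w =>
  at_least_min_sync_level A (size w) /\ forces w t.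

(* [word_at w p i] applies the first [i] states of [p] to [w] in turn: for
   p = (p_1, ..., p_l), it is the word Gamma_i with Gamma_0 = w and
   Gamma_i = lambda(Gamma_(i-1), p_i). *)
Definition word_at w (p : seq Q) (i : nat) : seq 'I_n :=
  foldl (fun v q => lambdaw v q) w (take i p).

(* ((q_1..q_l), (p_1..p_l), G) is a split of level r witnessed by t1, t2; the
   states s_1..s_l are indexed from 0. *)
Definition split_to r l (q p : l.-tuple Q) (G : r.-tuple 'I_n) (t1 t2 : Q) :=
  [/\ 1 <= l, t1 <> t2,
      exists s : l.-tuple Q, forall i : 'I_l,
        W (tnth s i) (word_at G p i) /\ W (tnth s i) (word_at G q i),
      W t1 (word_at G p l) & W t2 (word_at G q l)].

Definition split_with_bottom r l (q p : l.-tuple Q) (G : r.-tuple 'I_n)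
    (b : {set Q}) : Prop :=
  exists t1 t2, split_to q p G t1 t2 /\ b = [set t1; t2]%SET.

Definition split_top l (q p : l.+1.-tuple Q) : {set Q} := [set thead p; thead q]%SET.

(* Here the length of the split is l+1, so that U_1 and U_2 have length l. *)
Definition bottom_depends_only_on_top r l (q p : l.+1.-tuple Q)
    (G : r.-tuple 'I_n) (b : {set Q}) : Prop :=
  split_with_bottom q p G b /\
  forall U1 U2 : l.-tuple Q,
    split_with_bottom [tuple of thead q :: U1] [tuple of thead p :: U2] G b /\
    forall u u' : Q,
      @piw (power A l.+2) G [tuple of rcons p u] =
        @piw (power A l.+2) G [tuple of rcons (thead p :: U2) u'] /\
      @piw (power A l.+2) G [tuple of rcons q u] =
        @piw (power A l.+2) G [tuple of rcons (thead q :: U1) u'].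

Definition good_split r (a b : {set Q}) : Prop :=
  exists l (q p : l.+1.-tuple Q) (G : r.-tuple 'I_n),
    a = split_top q p /\ bottom_depends_only_on_top q p G b.

Definition bad_pair r (a : {set Q}) : Prop := exists b, good_split r a b.

Definition bad_edge r (a b : {set Q}) : Prop :=
  [/\ bad_pair r a, bad_pair r b & good_split r a b].

Definition has_loop r : Prop := exists a, bad_edge r a a.

End Splits.
End Transducers.

(* Main.v *)
Require Import Defs.
From mathcomp Require Import all_boot.
From mathcomp Require Import all_classical topology.

(* The second alternative always holds.  Fix a state [q] and let a = A_q.
   Synchronization makes any two products of m generators agree beyond position
   k * m.  If no pair (A_q, A_p) is free, each relation between A_q and A_p
   improves this to a bound D uniform in m: a^i A_p and a^(i+1) agree beyond D
   for all i, hence every product of m generators agrees with a^m beyond D.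
   Such a product is then determined, given m, by its action on prefixes of
   length D; so each power of A has boundedly many inequivalent states, whence
   the automaton semigroup is finite, and so is the group. *)

Set Implicit Arguments.
Unset Strict Implicit.
Unset Printing Implicit Defensive.

(** * Infinite words, and self-maps that agree beyond a position *)

Section Streams.
Variable n : nat.
Implicit Types (u v : Xomega n) (f g h : Xomega n -> Xomega n).

Definition scons (x : 'I_n) u : Xomega n :=
  fun i => if i is j.+1 then u j else x.

Definition stail u : Xomega n := fun i => u i.+1.

Lemma scons_eta u : scons (u 0) (stail u) = u.
Proof. by apply: funext => -[]. Qed.

Lemma induced_scons (A : transducer n) (q : state A) x u :
  induced q (scons x u) = scons (lambda x q) (induced (Defs.pi x q) u).
Proof.
apply: funext => -[|i] //=; rewrite /induced /=; congr (lambda _ _).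
rewrite /mkseq /= -[1]addn0 iotaDl -map_comp /piw /=.
by congr (foldl _ _ _); apply: eq_map.
Qed.

Definition agree D f g := forall u i, D <= i -> f u i = g u i.

Lemma agree_sym D f g : agree D f g -> agree D g f.
Proof. by move=> fg u i /fg->. Qed.

Lemma agree_trans D f g h : agree D f g -> agree D g h -> agree D f h.
Proof. by move=> fg gh u i Di; rewrite fg// gh. Qed.

Lemma agree_le D D' f g : D <= D' -> agree D f g -> agree D' f g.
Proof. by move=> DD fg u i Di; apply: fg; apply: leq_trans Di. Qed.

Lemma agree_compr D f g h : agree D f g -> agree D (f \o h) (g \o h).
Proof. by move=> fg u i Di /=; apply: fg. Qed.

Definition surj f := forall v, exists u, f u = v.

Lemma surj_cancel h f g : surj h -> f \o h = g \o h -> f = g.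
Proof.
move=> sh e; apply: funext => v; have [u <-] := sh v.
exact: (congr1 (fun k => k u) e).
Qed.

Lemma agree_surj D h f g : surj h -> agree D (f \o h) (g \o h) -> agree D f g.
Proof. by move=> sh fg v; have [u <-] := sh v; apply: fg. Qed.

End Streams.

(** * Products of generators as words of states *)

Section Words.
Variables (n : nat) (A : transducer n).
Local Notation Q := (state A).
Implicit Types (p q c : Q) (w : seq Q) (u v : Xomega n) (x : 'I_n).

(* The rightmost letter acts first, as in the foldr of [free_family]. *)
Definition wmap w : Xomega n -> Xomega n :=
  foldr (fun c f => induced c \o f) id w.

Lemma wmap_cat w w' : wmap (w ++ w') = wmap w \o wmap w'.
Proof. by elim: w => //= c w ->. Qed.

(** A word of states is treated as a state of a power of [A]: [wout] and [wnext] are the output and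
    transition functions of that power, with the rightmost state reading first. *)
Fixpoint wout x w : 'I_n := if w is c :: w' then lambda (wout x w') c else x.

Fixpoint wnext x w : seq Q :=
  if w is c :: w' then Defs.pi (wout x w') c :: wnext x w' else [::].

Lemma size_wnext x w : size (wnext x w) = size w.
Proof. by elim: w => //= c w ->. Qed.

Lemma wmap_scons w x u :
  wmap w (scons x u) = scons (wout x w) (wmap (wnext x w) u).
Proof. by elim: w => //= c w ->; rewrite induced_scons. Qed.

Lemma wmap_eq_step w w' x : wmap w = wmap w' ->
  wout x w = wout x w' /\ wmap (wnext x w) = wmap (wnext x w').
Proof.
move=> e; split.
  have := congr1 (fun f => f (scons x (fun=> x)) 0) e.
  by rewrite /= !wmap_scons.
apply: funext => u; have := congr1 (fun f => f (scons x u)) e.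
rewrite !wmap_scons => /(congr1 (@stail n)).
by rewrite /stail /=.
Qed.

Lemma induced_causal q u v D i : (forall j, j < D -> u j = v j) -> i < D ->
  induced q u i = induced q v i.
Proof.
move=> uv iD; rewrite /induced uv//; congr (lambda _ (piw _ _)).
apply/eq_in_map => j; rewrite mem_iota add0n => /andP[_ ji].
by apply: uv; apply: ltn_trans iD.
Qed.

Lemma wmap_causal w u v D i : (forall j, j < D -> u j = v j) -> i < D ->
  wmap w u i = wmap w v i.
Proof.
move=> uv; elim: w i => [|c w IH] i iD /=; first exact: uv.
exact: induced_causal iD.
Qed.

(** [h] is a morphism of transducers on the words satisfying [P]; outputs then agree position by
    position, by induction on the position. *)
Lemma wmap_induced (B : transducer n) (P : seq Q -> Prop) (h : seq Q -> state B) :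
  (forall w x, P w -> [/\ P (wnext x w), lambda x (h w) = wout x w
                        & Defs.pi x (h w) = h (wnext x w)]) ->
  forall w, P w -> wmap w = induced (h w).
Proof.
move=> hP w Pw; apply: funext => u; apply: funext => i.
elim: i w Pw u => [|i IH] w Pw u; rewrite -[u]scons_eta wmap_scons induced_scons /=.
  by have [] := hP w (u 0) Pw.
by have [Pw' _ ->] := hP w (u 0) Pw; apply: IH.
Qed.

Lemma wmap_surj w : (forall c : Q, surj (induced c)) -> surj (wmap w).
Proof.
move=> surjA; elim: w => [v|c w IH v] /=; first by exists v.
have [u <-] := surjA c v; have [t <-] := IH u; by exists t.
Qed.

(** * Agreement bounds from synchronization *)

Section Synchronizing.
Variable k : nat.
Hypothesis syncA : sync_at A k.

Lemma piw_forget (s : seq 'I_n) p q : k <= size s -> piw s p = piw s q.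
Proof.
case: syncA => f hf ks; rewrite -(cat_take_drop k s) /piw !foldl_cat.
have st : size (take k s) == k by rewrite size_takel.
by congr (foldl _ _ _); have := hf (Tuple st); rewrite /piw /= => h; rewrite !h.
Qed.

Lemma agree_induced p q : agree k (induced p) (induced q).
Proof.
by move=> u i ki; rewrite /induced (@piw_forget _ p q)// size_mkseq.
Qed.

(** Reading the first D letters may lead [c] to two different states, but the next k letters are
    common to both inputs and force the same state. Composing on the left thus costs k, whereas
    composing on the right ([agree_compr]) is free. *)
Lemma agree_compl D f g c :
  agree D f g -> agree (D + k) (induced c \o f) (induced c \o g).
Proof.
move=> fg u i Dki /=; have Di : D <= i by apply: leq_trans Dki; apply: leq_addr.
rewrite /induced fg//; congr (lambda _ _).
rewrite -(subnKC Di) /mkseq iotaD !map_cat /piw !foldl_cat add0n.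
have -> : [seq f u j | j <- iota D (i - D)] = [seq g u j | j <- iota D (i - D)].
  by apply/eq_in_map => j; rewrite mem_iota => /andP[Dj _]; apply: fg.
by apply: piw_forget; rewrite size_map size_iota leq_subRL.
Qed.

Lemma agree_wmap_compl D f g w : agree D f g ->
  agree (D + k * size w) (wmap w \o f) (wmap w \o g).
Proof.
move=> fg; elim: w => [|c w IH] /=; first by rewrite muln0 addn0.
by rewrite mulnS addnCA addnC; apply: agree_compl IH.
Qed.

Lemma agree_wmap q w : agree (k * size w) (wmap w) (wmap (nseq (size w) q)).
Proof.
elim: w => [|c w IH] //=; rewrite mulnS addnC.
apply: agree_trans (agree_compl q IH).
apply: (@agree_le _ k); first exact: leq_addl.
by apply: agree_compr; apply: agree_induced.
Qed.

(** The letters of [w] are replaced by [q] one at a time from the left. The letters still to be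
    replaced act first, so each step is a composition on the right and D does not grow. *)
Lemma agree_chain D q w i :
  (forall j c, j < size w -> c \in w ->
     agree D (wmap (nseq (i + j) q ++ [:: c])) (wmap (nseq (i + j).+1 q))) ->
  agree D (wmap (nseq i q ++ w)) (wmap (nseq (i + size w) q)).
Proof.
elim: w i => [|c w IH] i h; first by rewrite cats0 addn0.
rewrite -cat1s catA (wmap_cat _ w) /= addnS -addSn.
apply: agree_trans (IH i.+1 _).
  rewrite (wmap_cat _ w); apply: agree_compr.
  by have := h 0 c isT (mem_head c w); rewrite addn0.
by move=> j d jw dw; rewrite addSnnS; apply: h => //; rewrite inE dw orbT.
Qed.

(** * Uniform bounds from relations *)

Hypothesis surjA : forall c : Q, surj (induced c).

(** Strong induction on i. For i below l = |w| the crude bound of [agree_wmap] suffices. Otherwise,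
    with i = i' + l, the chain is q^i p ~ q^i' w p = q^i' w' q ~ q^(i+1): both replacements of a
    word by q^l only use the bound at exponents below i. *)
Lemma eq_length_relation_agree p q (w w' : seq Q) :
  size w = size w' -> {subset w <= [:: p; q]} -> {subset w' <= [:: p; q]} ->
  wmap (w ++ [:: p]) = wmap (w' ++ [:: q]) ->
  exists D, forall i, agree D (wmap (nseq i q ++ [:: p])) (wmap (nseq i.+1 q)).
Proof.
move=> sw wpq w'pq e; exists (k * (size w).+1) => i.
have [m] := ubnP i; elim: m i => // m IH i; rewrite ltnS => im.
have [iw|iw] := ltnP i (size w).
  apply: (@agree_le _ (k * i.+1)); first by rewrite leq_mul2l ltnW ?orbT.
  have := @agree_wmap q (nseq i q ++ [:: p]).
  by rewrite size_cat size_nseq addn1.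
rewrite -(subnK iw); set i' := i - size w.
have chain (s : seq Q) : size s = size w -> {subset s <= [:: p; q]} ->
    agree (k * (size w).+1) (wmap (nseq i' q ++ s)) (wmap (nseq (i' + size w) q)).
  move=> ss spq; have := @agree_chain (k * (size w).+1) q s i'; rewrite ss; apply=> j c js cs.
  have /(spq _) := cs; rewrite !inE => /orP[] /eqP->.
    by apply: IH; apply: leq_trans im; rewrite -(subnK iw) ltn_add2l.
  by rewrite -(nseqD _ 1 q) addn1.
have cp : agree (k * (size w).+1) (wmap (nseq i' q ++ w ++ [:: p]))
                (wmap (nseq (i' + size w) q ++ [:: p])).
  by rewrite catA !(wmap_cat _ [:: p]); apply: agree_compr; apply: chain.
apply: agree_trans (agree_sym cp) _.
rewrite wmap_cat e -wmap_cat catA -[(i' + _).+1]addn1 nseqD !(wmap_cat _ [:: q]).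
by apply: agree_compr; apply: chain.
Qed.

(** Exponents of [q] reduce modulo j: every q^(tj) agrees with the identity beyond D, so q^i c is
    compared with q^(i mod j) q. Exchanging c for q costs k, and the fewer than j letters on the
    left cost at most k * j. *)
Lemma torsion_agree p q D j : 0 < j -> agree D id (wmap (nseq j q)) ->
  exists D', forall i, agree D' (wmap (nseq i q ++ [:: p])) (wmap (nseq i.+1 q)).
Proof.
move=> j0 idj; exists (D + k + k * j) => i.
have idt t : agree D id (wmap (nseq (t * j) q)).
  elim: t => // t IH; rewrite mulSn nseqD wmap_cat.
  by apply: agree_trans IH _; apply: (agree_compr (f := id)).
have red c : agree (D + k + k * j) (wmap (nseq i q ++ [:: c]))
               (wmap (nseq (i %% j) q) \o induced q).
  rewrite {1}(divn_eq i j) (addnC (i %/ j * j)) nseqD -catA !wmap_cat.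
  apply: (@agree_le _ (D + k + k * size (nseq (i %% j) q))).
    by rewrite leq_add2l leq_mul2l size_nseq ltnW ?orbT// ltn_mod.
  apply: agree_wmap_compl; apply: (@agree_trans _ _ _ (induced c)).
    apply: (@agree_le _ D); first exact: leq_addr.
    by apply/agree_sym/(agree_compr (f := id)).
  by apply: agree_le (agree_induced _ _); apply: leq_addl.
apply: agree_trans (red p) _; apply: agree_sym.
by have := red q; rewrite -(nseqD _ 1 q) addn1.
Qed.

(** Both sides agree with powers of [q] beyond k * |w'|. Cancelling q^|w| on the right, which
    surjectivity allows, leaves a positive power of [q] that agrees with the identity there. *)
Lemma lt_length_relation_agree p q (w w' : seq Q) :
  size w < size w' -> wmap w = wmap w' ->
  exists D, forall i, agree D (wmap (nseq i q ++ [:: p])) (wmap (nseq i.+1 q)).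
Proof.
move=> ww e; apply: (@torsion_agree _ _ (k * size w') (size w' - size w)).
  by rewrite subn_gt0.
apply: (@agree_surj _ _ (wmap (nseq (size w) q))); first exact: wmap_surj.
rewrite -wmap_cat -nseqD subnK ?(ltnW ww)//.
apply: agree_trans _ (@agree_wmap q w'); rewrite -e; apply: agree_sym.
by apply: agree_le (@agree_wmap q w); rewrite leq_mul2l ltnW ?orbT.
Qed.

Lemma last_letter_relation (I : eqType) (b : I -> Q) (s t : seq I) :
  size s = size t -> s <> t -> wmap (map b s) = wmap (map b t) ->
  exists (s' t' : seq I) (c d : I), [/\ size s' = size t', c <> d &
    wmap (map b s' ++ [:: b c]) = wmap (map b t' ++ [:: b d])].
Proof.
elim/last_ind: s t => [|s c IH] t; first by case: t.
case/lastP: t => [|t d]; first by rewrite size_rcons.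
rewrite !size_rcons => -[st] neq; rewrite !map_rcons -!cats1.
have [dc|/eqP cd] := eqVneq c d; last by exists s, t, c, d.
(* A common last letter acts first, so it cancels by surjectivity. *)
subst d; rewrite !wmap_cat => e; apply: (IH t) => //; first by move=> st'; apply: neq; rewrite st'.
by apply: (surj_cancel _ e); apply: wmap_surj.
Qed.

Definition pair_family p q : bool -> Xomega n -> Xomega n :=
  fun b => induced (if b then p else q).

Lemma not_free_agree p q : ~ free_family (pair_family p q) ->
  exists D, forall i, agree D (wmap (nseq i q ++ [:: p])) (wmap (nseq i.+1 q)).
Proof.
pose b (c : bool) := if c then p else q.
have wE (s : seq bool) :
    foldr (fun i f => pair_family p q i \o f) id s = wmap (map b s).
  by rewrite /wmap foldr_map.
have bpq (s : seq bool) : {subset map b s <= [:: p; q]}.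
  by move=> _ /mapP[[] _ ->]; rewrite !inE eqxx ?orbT.
move=> nfree; apply: contrapT => nD; apply: nfree => s t _ _; rewrite !wE => e.
have [st|ts|st] := ltngtP (size s) (size t).
- case: nD; apply: (@lt_length_relation_agree _ _ (map b s) (map b t)) => //.
  by rewrite !size_map.
- case: nD; apply: (@lt_length_relation_agree _ _ (map b t) (map b s)) => //.
  by rewrite !size_map.
apply: contrapT => neq; apply: nD.
have [s' [t' [c [d [st' cd]]]]] := last_letter_relation st neq e.
(* Exchanging the two sides of the relation lets the first one end in [p]. *)
wlog [-> ->] : c d s' t' st' cd / c = true /\ d = false.
  move=> H; case: c d cd => -[] // _ e'; first exact: (H true false s' t').
  by apply: (H true false t' s').
by apply: eq_length_relation_agree; rewrite ?size_map.
Qed.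

(** * Finiteness from a uniform bound *)

Section Table.
Variables (x0 : 'I_n) (q : Q) (D : nat).
Hypothesis agreeD : forall w, agree D (wmap w) (wmap (nseq (size w) q)).

Local Notation T := {ffun D.-tuple 'I_n -> D.-tuple 'I_n}.

(** The action of [w] on prefixes of length D. Padding with [x0] only serves to obtain a stream: by
    [wmap_causal] it does not affect the first D outputs. *)
Definition table w : T :=
  [ffun t => [tuple wmap w (fun i => nth x0 (tval t) i) i | i < D]].

Lemma table_inj w w' : size w = size w' -> table w = table w' -> wmap w = wmap w'.
Proof.
move=> ss e; apply: funext => u; apply: funext => i.
have [Di|iD] := leqP D i; first by rewrite agreeD// ss -agreeD.
pose t := [tuple u i | i < D].
have ut j : j < D -> u j = nth x0 (tval t) j.
  by move=> jD; rewrite (_ : j = Ordinal jD)// -tnth_nth tnth_mktuple.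
rewrite !(@wmap_causal _ _ (nth x0 (tval t)) D)//.
have := congr1 (fun F : T => tnth (F t) (Ordinal iD)) e.
by rewrite !ffunE !tnth_mktuple.
Qed.

(** Tables serve as states and [delta] is a finite function, so the pairs ([delta], table) form one
    finite type that serves words of every length. *)
Definition table_transducer (delta : {ffun 'I_n * T -> T * 'I_n}) : transducer n :=
  @Transducer n T (fun x a => (delta (x, a)).1) (fun x a => (delta (x, a)).2).

Definition table_map (e : {ffun 'I_n * T -> T * 'I_n} * T) : Xomega n -> Xomega n :=
  @induced n (table_transducer e.1) e.2.

Lemma wmap_table w : exists e, wmap w = table_map e.
Proof.
pose m := size w.
(* On tables of words of length m, [delta] uses a chosen representative, which is harmless since by
   [table_inj] the table determines the map. Elsewhere its value is arbitrary. *)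
pose delta : {ffun 'I_n * T -> T * 'I_n} := [ffun xa =>
  if [pick s : m.-tuple Q | table s == xa.2] is Some s
  then (table (wnext xa.1 s), wout xa.1 s) else (xa.2, xa.1)].
exists (delta, table w); rewrite /table_map /=.
apply: (@wmap_induced (table_transducer delta) (fun s => size s = m)) => // s x sm.
have sm' : size s == m by apply/eqP.
rewrite /= !ffunE /=; case: pickP => [t /eqP ts|/(_ (Tuple sm'))]; last by rewrite eqxx.
have [-> nx] : wout x t = wout x s /\ wmap (wnext x t) = wmap (wnext x s).
  by apply: wmap_eq_step; apply: table_inj => //; rewrite size_tuple.
by rewrite size_wnext; split => //=; apply/ffunP => a; rewrite !ffunE nx.
Qed.

Lemma wmap_period w : exists i j, i < j /\
  wmap (flatten (nseq i w)) = wmap (flatten (nseq j w)).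
Proof.
pose E := ({ffun 'I_n * T -> T * 'I_n} * T)%type.
have [e eE] := choice (fun i => wmap_table (flatten (nseq i w))).
pose h (i : 'I_(#|{: E}|.+1)) : E := e i.
have /injectivePn[i [j ij hij]] : ~~ injectiveb h.
  by apply/injectiveP => /leq_card; rewrite card_ord ltnn.
have eij : wmap (flatten (nseq i w)) = wmap (flatten (nseq j w)).
  by rewrite !eE; congr table_map.
case: (ltngtP i j) => [lij|lij|/val_inj eij'].
- by exists i, j.
- by exists j, i.
- by rewrite eij' eqxx in ij.
Qed.

Lemma automaton_group_wmap f : automaton_group A f -> exists w, f = wmap w.
Proof.
elim=> [c||g h _ [w ->] _ [w' ->]|g h _ [w ->] gh hg].
- by exists [:: c].
- by exists [::].
- by exists (w ++ w'); rewrite wmap_cat.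
(* Cancelling w^i in w^i = w^j gives w^(j-i) = id, so the inverse of w is w^(j-i-1), again a product
   of generators. *)
have [i [j [ij e]]] := wmap_period w.
exists (flatten (nseq (j - i).-1 w)).
have idE : id = wmap (flatten (nseq (j - i) w)).
  apply: (@surj_cancel _ (wmap (flatten (nseq i w)))); first exact: wmap_surj.
  by rewrite -wmap_cat -flatten_cat -nseqD subnK ?(ltnW ij).
apply: funext => u; apply: (can_inj gh); rewrite hg.
rewrite -[in LHS]/(id u) idE -(@prednK (j - i)) ?subn_gt0//.
by rewrite /= wmap_cat.
Qed.

Lemma finite_automaton_group : finite_set (automaton_group A).
Proof.
apply: (@sub_finite_set _ _ (range table_map)).
  move=> f /automaton_group_wmap[w ->]; have [e ->] := wmap_table w.
  by exists e.
by apply: finite_image; apply: finite_finset.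
Qed.

End Table.

Lemma free_pair_of_infinite (x0 : 'I_n) q :
  infinite_set (automaton_group A) -> exists p, free_family (pair_family p q).
Proof.
move=> inf; apply: contrapT => nfree; apply: inf.
have /choice[D DP] : forall p, exists D, forall i,
    agree D (wmap (nseq i q ++ [:: p])) (wmap (nseq i.+1 q)).
  by move=> p; apply: not_free_agree => fr; apply: nfree; exists p.
(* The finitely many bounds, one for each state p, are replaced by their maximum. *)
apply: (@finite_automaton_group x0 q (\max_p D p)) => w.
apply: (@agree_chain _ q w 0) => j c _ _.
by apply: agree_le (DP c _); apply: leq_bigmax.
Qed.

End Synchronizing.

(** * Surjectivity of all state maps *)

Lemma bijective_induced_next q x :
  bijective (induced q) -> bijective (induced (Defs.pi x q)).
Proof.
move=> [g qK gK].
(* The first letter of a preimage under A_q gives a right inverse [r] of the letter map [l]; on a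
   finite alphabet this makes [l] a permutation. *)
pose l (z : 'I_n) := lambda z q; pose r (y : 'I_n) : 'I_n := g (fun=> y) 0.
have rK : cancel r l.
  by move=> y; apply: (congr1 (fun u => u 0) (gK (fun=> y))).
have [h hK Kh] := injF_bij (can_inj rK).
have linj : injective l by move=> y z; rewrite -(Kh y) -(Kh z) !rK => ->.
have tailE v : g (scons (lambda x q) v) = scons x (stail (g (scons (lambda x q) v))).
  rewrite -[LHS]scons_eta; congr scons; apply: linj.
  apply: (congr1 (fun u => u 0) (gK (scons (lambda x q) v))).
(* The inverse at the next state prefixes the output letter of x, applies [g], and drops the first
   letter, which is x by [tailE]. *)
exists (fun v => stail (g (scons (lambda x q) v))) => u.
  by rewrite -induced_scons qK.
have := gK (scons (lambda x q) u).
by rewrite tailE induced_scons => /(congr1 (@stail n)).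
Qed.

Lemma bijective_induced_piw q (w : seq 'I_n) :
  bijective (induced q) -> bijective (induced (piw w q)).
Proof. by elim: w q => //= x w IH q /(bijective_induced_next x)/IH. Qed.

Lemma Htilde_surj : in_Htilde A -> forall c : Q, surj (induced c).
Proof.
move=> [[_ coreA _] [q [_ [g [_ qK gK]]]]] c.
(* Since [A] is core, a word forcing [c] leads from the homeomorphism state [q] to [c]. *)
have [k [s [sA [G <-]]]] := coreA c; rewrite -(sA G q).
have [h _ hK] : bijective (induced (piw G q)).
  by apply: bijective_induced_piw; exists g.
by move=> v; exists (h v).
Qed.

End Words.

Theorem theorem1p3 (n : nat) (hn : 2 <= n) (A : transducer n)
  (hA : in_Htilde A) (hinf : infinite_set (automaton_group A)) :
  (exists j : nat, at_least_min_sync_level A j /\ has_loop A j) \/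
  (exists I : Type, (exists i1 i2 : I, i1 <> i2) /\
     contains_free_semigroup_on (automaton_semigroup A) I).
Proof.
right; exists bool; split; first by exists true, false.
have [[[k syncA] _ _] [q _]] := hA.
have [p free_pq] :=
  free_pair_of_infinite syncA (Htilde_surj hA) (Ordinal (ltnW hn)) q hinf.
by exists (pair_family p q); split=> // b; apply: semigroup_gen.
Qed.
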